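(* Let $v>k>2$ be integers and let $q$ be a prime power. If there exists an $\mathrm{EA}(q)$-additive $(v,k,1)$-design, then $q$ is a power of a prime divisor of $\frac{v-k}{k-1}$.
   Context: A $(v,k,\lambda)$-design is a pair $(V,\mathcal{B})$ where $V$ is a set of $v$ points and $\mathcal{B}$ is a collection of $k$-subsets of $V$ (blocks) such that every pair of distinct points is contained in exactly $\lambda$ blocks; it is assumed $v>k>2$. $\mathrm{EA}(q)$ denotes the elementary abelian group of order $q$ (the additive group of the field $\mathbb{F}_q$). For an abelian group $G$, a design is $G$-additive if, up to isomorphism, its points are elements of $G$ and every block is zero-sum in $G$ (the sum of its elements is $0$). *)

(* Defs.v *)
From mathcomp Require Import all_boot all_order all_algebra.
From mathcomp Require Import all_fingroup all_solvable.

Set Implicit Arguments.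
Unset Strict Implicit.
Unset Printing Implicit Defensive.

Import GRing.Theory.

(* The blocks are a list, i.e. a collection in which repetitions are counted;
   the point set V may be a proper subset of the carrier type T. *)
Definition is_design (v k lambda : nat) (T : finType)
    (V : {set T}) (B : seq {set T}) : Prop :=
  [/\ #|V| = v,
      forall b, b \in B -> b \subset V /\ #|b| = k
    & forall x y, x \in V -> y \in V -> x != y ->
        count (fun b : {set T} => (x \in b) && (y \in b)) B = lambda].

Definition design_iso (T U : finType) (V : {set T}) (B : seq {set T})
    (W : {set U}) (C : seq {set U}) : Prop :=
  exists f : T -> U,
    [/\ {in V &, injective f}, f @: V = W
      & perm_eq [seq f @: b | b : {set T} <- B] C].

Definition zero_sum (G : finZmodType) (b : {set G}) : Prop :=
  (\sum_(x in b) x = 0 :> G)%R.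

Definition additive_design (G : finZmodType) (T : finType)
    (V : {set T}) (B : seq {set T}) : Prop :=
  exists (W : {set G}) (C : seq {set G}),
    design_iso V B W C /\ forall b, b \in C -> zero_sum b.

(* As a finGroupType, a finZmodType carries its addition, so [set: G] is the
   additive group of G. *)
Definition is_EA (q : nat) (G : finZmodType) : Prop :=
  #|G| = q /\ is_abelem [set: G].

(* EA(q) is unique up to isomorphism, so any representative may be used. *)
Definition EA_additive_design (q : nat) (T : finType)
    (V : {set T}) (B : seq {set T}) : Prop :=
  exists G : finZmodType, is_EA q G /\ additive_design G V B.

Definition prime_power (q : nat) : Prop :=
  exists p n : nat, [/\ prime p, 0 < n & q = p ^ n].

(* Main.v *)
Require Import Defs.
From mathcomp Require Import all_boot all_order all_algebra.
From mathcomp Require Import all_fingroup all_solvable.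
From mathcomp Require Import zify.

(** Summing the zero-sum condition over the [r] blocks through a point [x] gives
    [(r - 1) x + S = 0], where [S] is the sum of all the points. Hence
    [(r - 1) (x - y) = 0] for any two points [x] and [y], while also
    [p (x - y) = 0]; if [p] were coprime to [r - 1 = (v - k) / (k - 1)], there
    would be only one point. *)

Set Implicit Arguments.
Unset Strict Implicit.
Unset Printing Implicit Defensive.

Import GRing.Theory.

Definition replication (T : finType) (B : seq {set T}) (x : T) : nat :=
  count (fun b : {set T} => x \in b) B.

(** Double counting: [x] is met once in each block through it, and any other point of [V] lies in
    exactly one of these blocks. The values are in an arbitrary [nmodType] so that the identity
    serves both for counting in [nat] and for sums in the group. *)
Lemma sum_blocks_through (v k : nat) (T : finType) (V : {set T})
    (B : seq {set T}) (M : nmodType) (f : T -> M) (x : T) :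
  is_design v k 1 V B -> x \in V ->
  (\sum_(b <- B | x \in b) \sum_(y in b) f y =
   f x *+ replication B x + \sum_(y in V | y != x) f y)%R.
Proof.
move=> [_ blockB lambda1] xV.
(* The inner range is made independent of [b], so that the two sums can be exchanged. *)
have -> : (\sum_(b <- B | x \in b) \sum_(y in b) f y =
    \sum_(b <- B | x \in b) \sum_(y in V) (if y \in b then f y else 0))%R.
  rewrite big_seq_cond [RHS]big_seq_cond; apply: eq_bigr => b /andP[/blockB[sbV _] _].
  rewrite -big_mkcondr; apply: eq_bigl => y /=.
  by case yb: (y \in b); rewrite ?andbF // (subsetP sbV).
rewrite exchange_big /= (bigD1 x) //=; congr (_ + _)%R.
  rewrite -big_mkcondr /= big_const_seq iter_addr_0.
  by congr (_ *+ _)%R; apply: eq_count => b; rewrite andbb.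
apply: eq_bigr => y /andP[yV yx].
rewrite -big_mkcondr /= big_const_seq lambda1 //= ?addr0 //.
by rewrite eq_sym.
Qed.

(** For [f] constantly 1, the double count reads [r * k = r + (v - 1)] with [r] the replication
    number of [x]. *)
Lemma replicationE (v k : nat) (T : finType) (V : {set T})
    (B : seq {set T}) (x : T) :
  is_design v k 1 V B -> x \in V -> replication B x * (k - 1) = v - 1.
Proof.
move=> D xV; have := sum_blocks_through (fun=> 1 : nat) D xV.
case: D => cardV blockB _.
rewrite big_seq_cond (eq_bigr (fun=> k)); last first.
  by move=> b /andP[/blockB[_ <-] _]; rewrite -sum1_card.
have -> : (\sum_(y in V | y != x) (1 : nat))%R = v - 1.
  rewrite -cardV (cardsD1 x) xV addKn -sum1_card.
  by apply: eq_bigl => y; rewrite !inE andbC.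
rewrite -big_seq_cond big_const_seq iter_addr_0 -/(replication B x).
have mulrnE (a c : nat) : (a *+ c)%R = a * c by rewrite -mulr_natr natn.
rewrite !mulrnE => /(congr1 (subn^~ (replication B x))).
by rewrite mul1n addKn mulnBr muln1 mulnC.
Qed.

Lemma EA_mulrn_eq0 (p n : nat) (G : finZmodType) (g : G) :
  prime p -> 0 < n -> is_EA (p ^ n) G -> (g *+ p = 0)%R.
Proof.
move=> p_pr n_gt0 [cardG].
(* The prime in [is_abelem] is [pdiv] of the order, which is [p] because [n] is positive. *)
rewrite /is_abelem cardsT cardG -(prednK n_gt0) pdiv_pfactor //.
by case/abelemP=> // _ /(_ g (in_setT g)); rewrite FinRing.zmodXgE.
Qed.

Lemma mulrn_coprime_eq0 (M : zmodType) (g : M) (m n : nat) :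
  0 < m -> coprime m n -> (g *+ m = 0)%R -> (g *+ n = 0)%R -> g = 0%R.
Proof.
move=> m_gt0 /eqP co_mn gm0 gn0.
(* Bezout without subtraction: [1 + a * n = c * m], so [g *+ (1 + a * n)] is both [0] and [g]. *)
have [a _ /dvdnP[c]] := Bezoutl n m_gt0; rewrite co_mn => eq_ac.
have: (g *+ (1 + a * n) = 0)%R by rewrite eq_ac mulnC mulrnA gm0 mul0rn.
by rewrite mulrnDr mulnC (mulrnA g n a) gn0 mul0rn addr0.
Qed.

Lemma additive_mulrn_eq (v k r : nat) (G : finZmodType) (T : finType)
    (V : {set T}) (B : seq {set T}) (f : T -> G) (x y : T) :
  is_design v k 1 V B ->
  (forall b, b \in B -> \sum_(z in b) f z = 0)%R ->
  x \in V -> y \in V -> replication B x = r.+1 -> replication B y = r.+1 ->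
  (f x *+ r = f y *+ r)%R.
Proof.
move=> D zeroB xV yV rx ry.
have mulrE z : z \in V -> replication B z = r.+1 ->
    (f z *+ r = - \sum_(t in V) f t)%R.
  (* The term [f z] of the sum over [V] joins the [r] copies to make [r.+1], the multiplicity of
     [f z] in the sum over the blocks through [z]. *)
  move=> zV rz; apply/eqP; rewrite -addr_eq0 (bigD1 z) //= addrA -mulrSr -rz.
  rewrite -(sum_blocks_through f D zV).
  by rewrite big_seq_cond big1 // => b /andP[/zeroB].
by rewrite !mulrE.
Qed.

Theorem theorem2p1 (v k q : nat) (hk : 2 < k) (hkv : k < v)
    (hq : prime_power q)
    (hD : exists (T : finType) (V : {set T}) (B : seq {set T}),
        is_design v k 1 V B /\ EA_additive_design q V B) :
  k - 1 %| v - k /\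
  exists p n : nat,
    [/\ prime p, p %| (v - k) %/ (k - 1), 0 < n & q = p ^ n].
Proof.
case: hq hD => p [n [p_pr n_gt0 ->]] [T [V [B [D [G [EAG]]]]]].
case=> [W [C [[f [f_inj _ permC]] zeroC]]].
have [cardV blockB _] := D.
(* Zero sums are pulled back along [f], which is injective on each block since blocks lie in [V]. *)
have zeroB b : b \in B -> (\sum_(z in b) f z = 0)%R.
  move=> bB; have [sbV _] := blockB b bB.
  have: zero_sum (f @: b).
    by apply: zeroC; rewrite -(perm_mem permC); apply: map_f.
  rewrite /zero_sum big_imset //=.
  by move=> y z /(subsetP sbV) yV /(subsetP sbV); apply: f_inj.
have /card_gt1P[x [y [xV yV xy]]] : 1 < #|V| by rewrite cardV; lia.
have k1_gt0 : 0 < k - 1 by lia.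
have rx := replicationE D xV; have ry := replicationE D yV.
have rxy : replication B y = replication B x.
  by apply/eqP; rewrite -(eqn_pmul2r k1_gt0) rx ry.
(* Replication 0 would force [v = 1]. Otherwise, subtracting [k - 1] from [r.+1 * (k - 1) = v - 1]
   identifies [r] as the quotient in the statement. *)
case Dr: (replication B x) rx => [|r] rx; first by lia.
have vkE : v - k = r * (k - 1) by nia.
split; first by rewrite vkE dvdn_mull.
exists p, n; split=> //; rewrite vkE mulnK //.
have [//|ndvd] := boolP (p %| r).
case/negP: xy; apply/eqP/f_inj => //; apply/eqP; rewrite -subr_eq0; apply/eqP.
apply: (@mulrn_coprime_eq0 _ _ p r); rewrite ?prime_gt0 ?prime_coprime //.
  exact: EA_mulrn_eq0 EAG.
by rewrite mulrnBl (additive_mulrn_eq D zeroB xV yV Dr) ?subrr // rxy.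
Qed.
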